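(* Let $(\Omega,\mathcal A,\mu,d)$ be a metric measure space equipped with a Borel probability measure $\mu$, let $\{E_i\}_{i\in\mathbb N}$ be a sequence of Borel subsets of $\Omega$, and let $E_\infty:=\limsup_{i\to\infty}E_i=\bigcap_{t=1}^\infty\bigcup_{i=t}^\infty E_i$. Suppose there exists an increasing function $f:(0,+\infty)\to(0,+\infty)$ with $f(x)\to0$ as $x\to0$ such that for any open set $A\subset\Omega$ with $\mu(A)>0$ there is a sequence $\{L_{i,A}\}_{i\in\mathbb N}$ of measurable sets with $L_{i,A}\subset E_i\cap A$ for all $i$ such that $$\sum_{i=1}^\infty\mu(L_{i,A})=\infty \qquad (1)$$ and, for infinitely many $Q\in\mathbb N$, $$\sum_{s,t=1}^Q\mu(L_{s,A}\cap L_{t,A})\le\frac{1}{f(\mu(A))}\left(\sum_{s=1}^Q\mu(L_{s,A})\right)^2. \qquad (2)$$ Then $\mu(E_\infty)=1$. Moreover, if in addition $\mu$ is doubling and $f(x)=cx$ for some constant $0<c\le1$, then for the conclusion $\mu(E_\infty)=1$ it suffices to assume the existence of such sequences $\{L_{i,A}\}_{i\in\mathbb N}$ (with $L_{i,A}\subset E_i\cap A$, (1), and (2) for infinitely many $Q$) only when $A$ is an arbitrary ball of sufficiently small radius centred in $\operatorname{supp}\mu$ (i.e. for all balls $A$ centred in $\operatorname{supp}\mu$ of radius less than some fixed $r_1>0$).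
   Context: $(\Omega,d)$ is a metric space, $\mathcal A$ is a $\sigma$-algebra on $\Omega$ containing all Borel sets, and $\mu$ is a probability measure on $\mathcal A$. $\operatorname{supp}\mu$ denotes the support of $\mu$, i.e. the smallest closed set of full $\mu$-measure. For $x\in\Omega$ and $r>0$, $B(x,r)=\{y\in\Omega: d(x,y)<r\}$ is the ball centred at $x$ of radius $r$. The measure $\mu$ is doubling if there are constants $\lambda\ge1$ and $r_0>0$ such that $\mu(B(x,2r))\le\lambda\,\mu(B(x,r))$ for all $x\in\operatorname{supp}\mu$ and $0<r<r_0$. *)

(* Defs.v *)
From HB Require Import structures.
From mathcomp Require Import all_boot all_order all_algebra.
From mathcomp Require Import all_classical all_reals all_analysis.

Set Implicit Arguments.
Unset Strict Implicit.
Unset Printing Implicit Defensive.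

Import Order.TTheory GRing.Theory Num.Theory.
Import numFieldNormedType.Exports.

Local Open Scope classical_set_scope.
Local Open Scope ring_scope.

(* A set carrying both a metric and a sigma-algebra. The structure itself does
   not relate the two: that the open sets are measurable is a separate
   hypothesis wherever it is needed. *)
#[short(type="metricMeasurableType")]
HB.structure Definition MetricMeasurable (K : numDomainType)
  (d : measure_display) := {T of Measurable d T & Metric K T}.

Section defs.
Context (R : realType) (d : measure_display) (T : metricMeasurableType R d).
Variable P : probability T R.

(* Borel sets of the metric topology; the sigma-algebra on which P is defined
   may be strictly larger. *)
Definition borel_set : set (set T) := <<s [set A : set T | open A] >>.

(* S is the smallest closed set of full measure. This is a relation because on
   a non-separable space such a set need not exist. *)
Definition is_support (S : set T) : Prop :=
  [/\ closed S, P S = 1%E & forall F : set T, closed F -> P F = 1%E -> S `<=` F].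

(* P is doubling, S standing for the support of P. *)
Definition doubling (S : set T) : Prop :=
  exists lambda r0 : R, [/\ 1 <= lambda, 0 < r0 &
    forall (x : T) (r : R), S x -> 0 < r -> r < r0 ->
      (P (ball x (2 * r)) <= lambda%:E * P (ball x r))%E].

(* The sets E_1, E_2, ... are indexed from 0, so the sums over s, t = 1, ..., Q
   range over the indices 0, ..., Q - 1. *)
Definition quasi_independent_in (f : R -> R) (E : nat -> set T) (A : set T)
    : Prop :=
  exists L : nat -> set T,
    [/\ forall i, measurable (L i),
        forall i, L i `<=` E i `&` A,
        (\sum_(0 <= i <oo) P (L i) = +oo)%E &
        forall N : nat, exists2 Q : nat, (N <= Q)%N &
          (\sum_(s < Q) \sum_(t < Q) P (L s `&` L t)
             <= ((f (fine (P A)))^-1)%:E * (\sum_(s < Q) P (L s)) ^+ 2)%E].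

End defs.

(* Main.v *)
Require Import Defs.
From HB Require Import structures.
From mathcomp Require Import all_boot all_order all_algebra.
From mathcomp Require Import all_classical all_reals all_analysis.
From mathcomp Require Import ring lra.

(** The Kochen-Stone lemma turns (1) and (2) into
    [f (mu A) <= mu (E_oo `&` A)] for the admissible sets [A].

    If the complement of [E_oo] had positive measure [p], outer regularity would
    give an open [U] containing it with [mu (U `&` E_oo) < f p <= f (mu U)],
    a contradiction.

    In the doubling case, take [U] with [mu (U `&` E_oo)] small and keep only
    the points [x] of [S `\` E_oo] with [ball x r' `<=` U], for a fixed [r']
    so small that little measure is lost. As all these points admit the same
    radius, no Vitali covering is needed: for [r <= r'], a maximal disjoint
    family of balls [ball x r] centred at them covers them after doubling the
    radii once. Hence their measure is at most
    [lambda / c * mu (U `&` E_oo)], which is arbitrarily small. *)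

Set Implicit Arguments.
Unset Strict Implicit.
Unset Printing Implicit Defensive.

Import Order.TTheory GRing.Theory Num.Theory.
Import numFieldNormedType.Exports.

Local Open Scope classical_set_scope.
Local Open Scope ring_scope.

(** Since the total mass is 1, at most [n] disjoint members can have measure above [1 / (n + 1)],
    and every index in [D] passes this threshold for some [n]. *)
Lemma countable_trivIset_measure_gt0 d (T : measurableType d) (R : realType)
    (P : probability T R) (I : Type) (D : set I) (F : I -> set T) :
    (forall i, measurable (F i)) -> trivIset D F ->
    (forall i, D i -> (0 < P (F i))%E) ->
  countable D.
Proof.
elim/Ppointed: I => I in D F *; first by rewrite emptyE.
move=> mF tF F0; pose DD n := [set i | D i /\ n.+1%:R^-1 < fine (P (F i))].
have -> : D = \bigcup_n DD n.
  apply/seteqP; split => [i Di|i [n _ []]//].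
  have /ltr_add_invr[n] : 0 < fine (P (F i)).
    by rewrite fine_gt0// F0//= -ge0_fin_numE// fin_num_measure.
  by rewrite add0r => ni; exists n.
apply: bigcup_countable => // n _; apply: finite_set_countable.
apply: contrapT => /infiniteP/pcard_leP/injfunPex[/= q q_fun q_inj].
have /(probability_le1 P) : measurable (\bigcup_k F (q k)).
  exact: bigcupT_measurable.
rewrite leNgt => /negP; apply.
have tFq : trivIset setT (F \o q).
  move=> i j _ _ Fij; apply: q_inj; rewrite ?inE//.
  by apply: tF Fij; [have [] := q_fun i Logic.I|have [] := q_fun j Logic.I].
rewrite [ltRHS](_ : _ = \sum_(0 <= k <oo) P (F (q k)))%E; last first.
  rewrite (measure_bigcup P setT (F \o q)) => // [|k _]; last exact: mF.
  by apply: eq_eseriesl => k; rewrite in_setT.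
apply: (lt_le_trans _ (nneseries_lim_ge n.+1 _)) => //.
rewrite -EFin_sum_fine//; last by move=> ? _; rewrite fin_num_measure.
rewrite lte_fin (_ : 1%R = (\sum_(0 <= k < n.+1) n.+1%:R^-1:R)%R); last first.
  by rewrite sumr_const_nat subn0 -[RHS]mulr_natr mulVf.
by apply: ltr_sum => // k _; have [] := q_fun k Logic.I.
Qed.

(** * The Chung-Erdős inequality and the Kochen-Stone lemma *)

Section kochen_stone.
Context d (T : measurableType d) (R : realType) (P : probability T R).

Let m (A : set T) : R := fine (P A).

Lemma fine_probability_le (A B : set T) : measurable A -> measurable B ->
  A `<=` B -> fine (P A) <= fine (P B).
Proof.
by move=> mA mB AB; rewrite fine_le ?fin_num_measure ?le_measure ?inE.
Qed.

Lemma fine_probabilityDI (A B : set T) : measurable A -> measurable B ->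
  fine (P A) = fine (P (A `\` B)) + fine (P (A `&` B)).
Proof.
move=> mA mB; rewrite -fineD ?fin_num_measure//.
- by rewrite -measureDI.
- exact: measurableD.
- exact: measurableI.
Qed.

(* The left-hand side is the integral over U of the square of
   [a - \sum_(i < n) \1_(A i)]. In the induction, [U] is cut along [A n],
   and [a] becomes [a - 1] on [U `&` A n]. *)
Lemma quadratic_indic_ge0 n (A : nat -> set T) (U : set T) (a : R) :
    (forall i, measurable (A i)) -> measurable U ->
  0 <= a ^+ 2 * fine (P U) - 2 * a * (\sum_(i < n) fine (P (U `&` A i)))
     + \sum_(i < n) \sum_(j < n) fine (P (U `&` (A i `&` A j))).
Proof.
move=> mA; rewrite -!/(m _); elim: n U a => [|n IH] U a mU.
  by rewrite !big_ord0 mulr0 subr0 addr0 mulr_ge0 ?sqr_ge0 ?fine_ge0.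
have mD := measurableD mU (mA n); have mI := measurableI _ _ mU (mA n).
have mDI B : measurable B ->
    m (U `&` B) = m ((U `\` A n) `&` B) + m (U `&` A n `&` B).
  move=> mB; rewrite /m (@fine_probabilityDI (U `&` B) (A n))//.
    by rewrite [in X in _ = _ + X]setIAC setDE setIAC -setDE.
  exact: measurableI.
have mUn : m U = m (U `\` A n) + m (U `&` A n) by exact: fine_probabilityDI.
pose S V := \sum_(i < n) m (V `&` A i).
pose D V := \sum_(i < n) \sum_(j < n) m (V `&` (A i `&` A j)).
have SE : S U = S (U `\` A n) + S (U `&` A n).
  by rewrite -big_split; apply: eq_bigr => i _; exact: mDI.
have DE : D U = D (U `\` A n) + D (U `&` A n).
  rewrite -big_split; apply: eq_bigr => i _; rewrite -big_split.
  by apply: eq_bigr => j _; apply: mDI; exact: measurableI.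
(* The pairs involving [n] give two equal cross sums and one diagonal term. With the new term of the
   linear sum, they are exactly what replaces [a] by [a - 1] on the piece of [U] inside [A n]. *)
have -> : \sum_(i < n.+1) \sum_(j < n.+1) m (U `&` (A i `&` A j)) =
    D U + 2 * S (U `&` A n) + m (U `&` A n).
  rewrite big_ord_recr/= big_ord_recr/= setIid addrA; congr (_ + _).
  under eq_bigr do rewrite big_ord_recr/=.
  rewrite big_split/= -addrA; congr (_ + _).
  rewrite mulr_natl mulr2n; congr (_ + _); apply: eq_bigr => i _.
    by rewrite setIA setIAC.
  by rewrite setIA.
rewrite big_ord_recr/= -/(S U) SE DE mUn.
have := IH _ a mD; have := IH _ (a - 1) mI.
rewrite -!/(m _) -!/(S _) -!/(D _); lra.
Qed.

(** The quadratic in [a] of [quadratic_indic_ge0] is nonnegative everywhere, so its discriminant is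
    at most 0. *)
Lemma chung_erdos n (A : nat -> set T) (U : set T) :
    (forall i, measurable (A i)) -> measurable U -> (forall i, A i `<=` U) ->
  (\sum_(i < n) fine (P (A i))) ^+ 2 <=
    fine (P U) * \sum_(i < n) \sum_(j < n) fine (P (A i `&` A j)).
Proof.
move=> mA mU AU; set D := \sum_(i < n) _; set S := \sum_(i < n) _.
pose p := Poly [:: D; - (2 * S); fine (P U)].
have : p`_1 ^+ 2 - 4 * p`_2 * p`_0 <= 0.
  apply: deg_le2_poly_ge0 => [|a]; first exact: size_Poly.
  rewrite horner_Poly/=.
  have := quadratic_indic_ge0 n a mA mU.
  under eq_bigr do rewrite setIidr//.
  have AIU i j : A i `&` A j `<=` U by move=> x [/AU].
  under [X in _ + X]eq_bigr do under eq_bigr do rewrite setIidr//.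
  rewrite -/S -/D; lra.
rewrite !coefE/=; lra.
Qed.

Lemma nneseries_unbounded (u : nat -> R) (M : R) :
    (forall i, 0 <= u i) -> (\sum_(0 <= i <oo) (u i)%:E = +oo)%E ->
  exists N, forall Q, (N <= Q)%N -> M <= \sum_(i < Q) u i.
Proof.
move=> u0 uoo.
have /cvgeyPge/(_ M)[N _ NM] :
    (\sum_(0 <= i < n) (u i)%:E)%E @[n --> \oo] --> +oo%E.
  by rewrite -uoo; apply: is_cvg_ereal_nneg_natsum => n _; rewrite lee_fin.
by exists N => Q /NM; rewrite sumEFin lee_fin big_mkord.
Qed.

(** By continuity from above it is enough to bound each tail union. There [chung_erdos] is applied
    to the sets of index at least [t]; as the series diverges, the finitely many terms dropped are
    negligible against the whole sum. *)
Lemma kochen_stone (L : nat -> set T) (k : R) :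
    (forall i, measurable (L i)) -> 0 < k ->
    (\sum_(0 <= i <oo) P (L i) = +oo)%E ->
    (forall N, exists2 Q : nat, (N <= Q)%N &
      (\sum_(s < Q) \sum_(t < Q) P (L s `&` L t)
        <= (k^-1)%:E * (\sum_(s < Q) P (L s)) ^+ 2)%E) ->
  (k%:E <= P (lim_sup_set L))%E.
Proof.
move=> mL k0 Loo QL.
have mLI s t : measurable (L s `&` L t) by exact: measurableI.
have {}QL N : exists2 Q, (N <= Q)%N &
    k * \sum_(s < Q) \sum_(t < Q) m (L s `&` L t)
      <= (\sum_(s < Q) m (L s)) ^+ 2.
  have [Q NQ] := QL N; exists Q => //; rewrite mulrC -ler_pdivlMr// mulrC.
  rewrite -lee_fin EFinM EFin_expe -!sumEFin.
  under [leLHS]eq_bigr do rewrite -sumEFin.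
  under [leLHS]eq_bigr do under eq_bigr do rewrite fineK ?fin_num_measure//.
  by under [in leRHS]eq_bigr do rewrite fineK ?fin_num_measure//.
have mU t : measurable (\bigcup_(j >= t) L j) by exact: bigcup_measurable.
suff tail t : k <= m (\bigcup_(j >= t) L j).
  have Lcvg := lim_sup_set_cvg P L mL.
  rewrite -(cvg_lim _ (Lcvg _))//; last first.
    by rewrite -ge0_fin_numE// fin_num_measure.
  apply: lime_ge.
    apply/cvg_ex; eexists; apply: Lcvg.
    by rewrite -ge0_fin_numE// fin_num_measure.
  apply: nearW => t; rewrite -[leRHS]fineK ?fin_num_measure// lee_fin.
  exact: tail.
rewrite leNgt; apply/negP; set u := m _ => uk.
pose s := \sum_(i < t) m (L i).
have m0 A : 0 <= m A by rewrite fine_ge0.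
have s0 : 0 <= s by exact: sumr_ge0.
(* The final contradiction needs [(k - u) * S > 2 * k * s]. Asking for [s + 1] instead of [s] makes
   this strict even when [s = 0]. *)
have [N SN] : exists N, forall Q, (N <= Q)%N ->
    2 * k * (s + 1) / (k - u) <= \sum_(i < Q) m (L i).
  apply: (@nneseries_unbounded (m \o L)) => [i|]; first exact: m0.
  rewrite -Loo.
  by apply: eq_eseriesr => i _; rewrite fineK// fin_num_measure.
have [Q] := QL (maxn t N); rewrite geq_max => /andP[tQ /SN].
set S := \sum_(i < Q) m _; set D := \sum_(i < Q) _ => SS kD.
(* Emptying the first [t] sets, rather than reindexing, keeps all sums over [i < Q]. *)
pose A i := if (t <= i)%N then L i else set0.
have mA i : measurable (A i) by rewrite /A; case: ifP.
have AU i : A i `<=` \bigcup_(j >= t) L j.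
  by rewrite /A; case: ifPn => // ti x Lx; exists i.
have AL i : A i `<=` L i by rewrite /A; case: ifPn => _ x.
have SA : S = s + \sum_(i < Q) m (A i).
  rewrite /S /s -!(big_mkord predT (m \o L)) -(big_mkord predT (m \o A)).
  rewrite !(big_cat_nat (leq0n t) tQ)/= addrA.
  congr (_ + _).
    rewrite [X in _ + X]big_nat_cond [X in _ + X]big1 ?addr0//.
    move=> i /andP[/andP[_ it] _].
    by rewrite /A leqNgt it/= /m measure0.
  by apply: eq_big_nat => i /andP[ti _]; rewrite /A ti.
have DA : \sum_(i < Q) \sum_(j < Q) m (A i `&` A j) <= D.
  apply: ler_sum => i _; apply: ler_sum => j _.
  apply: fine_probability_le => //; first exact: measurableI.
  exact: setISS.
have := chung_erdos Q mA (mU t) AU; rewrite -!/(m _) -/u.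
have SA0 : 0 <= \sum_(i < Q) m (A i) by exact: sumr_ge0.
have D0 : 0 <= D by apply: sumr_ge0 => i _; exact: sumr_ge0.
move: SS; rewrite ler_pdivrMr ?subr_gt0// => SS CE.
have CE' : (S - s) ^+ 2 <= u * D.
  rewrite [S in S - _]SA addrAC subrr add0r (le_trans CE)// ler_wpM2l//.
  exact: m0.
(* Expanded, this reads [(k - u) * S ^+ 2 <= 2 * k * s * S - k * s ^+ 2], against the choice of
   [N]. *)
have : k * (S - s) ^+ 2 <= u * S ^+ 2.
  rewrite (le_trans (ler_wpM2l (ltW k0) CE'))// mulrCA.
  by apply: ler_wpM2l; first exact: m0.
have sS : s <= S by rewrite SA lerDl.
have S0 : 0 < S.
  have ku : 0 < k - u by rewrite subr_gt0.
  rewrite -(pmulr_lgt0 _ ku); apply: lt_le_trans SS.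
  by rewrite !mulr_gt0 ?ltr_wpDl.
have : (2 * k * (s + 1)) * S <= S * (k - u) * S by rewrite ler_wpM2r// ltW.
have : 0 < k * S by rewrite mulr_gt0.
have : 0 <= k * s ^+ 2 by rewrite mulr_ge0 ?sqr_ge0// ltW.
nra.
Qed.

End kochen_stone.

(** * Continuity from above, open balls and erosions *)

Lemma nonincreasing_measure_lt d (T : measurableType d) (R : realType)
    (P : probability T R) (G : nat -> set T) (e : R) :
    (forall n, measurable (G n)) -> nonincreasing_seq G ->
    (P (\bigcap_n G n) < e%:E)%E ->
  exists n, (P (G n) < e%:E)%E.
Proof.
move=> mG niG Ge.
have mI : measurable (\bigcap_n G n) by exact: bigcap_measurableType.
have Goo : (P (G 0%N) < +oo)%E by rewrite -ge0_fin_numE// fin_num_measure.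
have /(_ _ (open_ereal_lt' Ge))[n _ /(_ n (leqnn n))] :
  P \o G @ \oo --> P (\bigcap_n G n) by exact: nonincreasing_cvg_mu.
by exists n.
Qed.

Lemma metric_ball_open (R : realType) (T : metricType R) (x : T) (r : R) :
  open (ball x r).
Proof.
rewrite openE => y; rewrite ballEmdist/= => xy.
apply/nbhs_ballP; exists (r - mdist x y) => /=; first by rewrite subr_gt0.
move=> z; rewrite !ballEmdist/= ltrBrDl.
exact/le_lt_trans/metric_triangle.
Qed.

(** By symmetry of the distance, the complement is a union of open balls centred outside [A]. *)
Lemma closed_erosion (R : realType) (T : metricType R) (A : set T) (r : R) :
  closed [set x | ball x r `<=` A].
Proof.
rewrite (_ : mkset _ = ~` \bigcup_(y in ~` A) ball y r).
  by apply/open_closedC/bigcup_open => y _; exact: metric_ball_open.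
apply/seteqP; split => [x xA [y yA /ball_sym /xA]//|x xA y xy].
by apply: contrapT => yA; apply: xA; exists y => //; exact: ball_sym.
Qed.

(** * Regularity of the measure on Borel sets *)

Section regularity.
Context (R : realType) (d : measure_display) (T : metricMeasurableType R d).
Variable P : probability T R.
Hypothesis open_meas : forall A : set T, open A -> measurable A.

Lemma closed_measurable (A : set T) : closed A -> measurable A.
Proof. by rewrite -openC => /open_meas/measurableC; rewrite setCK. Qed.

Lemma ball_measurable (x : T) (r : R) : measurable (ball x r).
Proof. by apply: open_meas; exact: metric_ball_open. Qed.

Lemma borel_set_measurable (A : set T) : borel_set A -> measurable A.
Proof.
apply: smallest_sub; [exact: sigma_algebra_measurable|exact: open_meas].
Qed.

(** The erosions of radius [1 / (n + 1)] increase to [A] because [A] is open. *)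
Lemma erosion_approx (A : set T) (e : R) : open A -> 0 < e ->
  exists2 r : R, 0 < r & (P (A `\` [set x | ball x r `<=` A]) < e%:E)%E.
Proof.
move=> oA e0; pose F n := [set x : T | ball x n.+1%:R^-1 `<=` A].
suff [n Pn] : exists n, (P (A `\` F n) < e%:E)%E by exists n.+1%:R^-1.
apply: nonincreasing_measure_lt => [n|i j ij|].
- apply: measurableD; first exact: open_meas.
  by apply: closed_measurable; exact: closed_erosion.
- apply/subsetPset; apply: setDS => x Fx y xy; apply: Fx.
  by apply: le_ball xy; rewrite lef_pV2 ?posrE// ler_nat.
- rewrite (_ : \bigcap_n _ = set0) ?measure0// -subset0 => x xF.
  have [Ax _] := xF 0%N I.
  have /nbhs_ballP[r /= r0 rA] : nbhs x A by exact: open_nbhs_nbhs.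
  have [n] := ltr_add_invr r0; rewrite add0r => nr.
  have [_] := xF n I; apply; apply: subset_trans rA.
  exact/le_ball/ltW.
Qed.

(** Approximation from both sides makes the condition symmetric under complement, so that the
    regular sets form a sigma-algebra. *)
Definition regular_set (B : set T) := forall e : R, 0 < e ->
  exists F U : set T, [/\ closed F, open U, F `<=` B, B `<=` U &
    (P (U `\` F) < e%:E)%E].

Lemma regular_bigcup (A : nat -> set T) :
  (forall n, regular_set (A n)) -> regular_set (\bigcup_n A n).
Proof.
move=> rA e e0.
(* These tolerances add up to [e / 2]; the other half pays for truncating the union of the [F n],
   which need not be closed, to a finite one. *)
have e2 n : 0 < e / 2 / (2 ^ n.+1)%:R by rewrite !divr_gt0 ?ltr0n ?expn_gt0.
have /choice[F /choice[U FU]] : forall n, exists F : set T, exists U : set T,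
    [/\ closed F, open U, F `<=` A n, A n `<=` U &
    (P (U `\` F) < (e / 2 / (2 ^ n.+1)%:R)%:E)%E] by move=> n; exact: rA.
have cF n : closed (F n) by have [] := FU n.
have oU n : open (U n) by have [] := FU n.
have oUU : open (\bigcup_n U n) by exact: bigcup_open.
have mF n : measurable (F n) by exact: closed_measurable.
have mU n : measurable (U n) by exact: open_meas.
pose FF n := \big[setU/set0]_(i < n) F i.
suff [n Pn] : exists n, (P (\bigcup_n U n `\` FF n) < e%:E)%E.
  exists (FF n), (\bigcup_n U n); split => //.
  - exact: closed_bigsetU.
  - rewrite /FF -bigcup_mkord => x [i _ Fx].
    by exists i => //; have [_ _ + _ _] := FU i; apply.
  - by move=> x [i _ Ax]; exists i => //; have [_ _ _ + _] := FU i; apply.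
apply: nonincreasing_measure_lt => [n|i j ij|].
- apply: measurableD; [exact: open_meas|exact: bigsetU_measurable].
- by apply/subsetPset; apply: setDS; exact: subset_bigsetU.
- have mUF n : measurable (U n `\` F n) by exact: measurableD.
  apply: (@le_lt_trans _ _ (e / 2)%:E); last first.
    by rewrite lte_fin ltr_pdivrMr// ltr_pMr// ltr1n.
  apply: (@le_trans _ _ (\sum_(n <oo) P (U n `\` F n))%E).
    apply: measure_sigma_subadditive => //.
      apply: bigcap_measurableType => n _.
      apply: measurableD; [exact: open_meas|exact: bigsetU_measurable].
    move=> x xUF; have [[n _ Unx] _] := xUF 0%N I.
    exists n => //; split => // Fnx; have [_] := xUF n.+1 I; apply.
    by rewrite /FF -bigcup_mkord; exists n => //=.
  apply: le_trans (epsilon_trick0 xpredT _); last by rewrite ltW// divr_gt0.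
  apply: lee_nneseries => n _ //; have [_ _ _ _ /ltW] := FU n.
  by [].
Qed.

Lemma borel_regular (B : set T) : borel_set B -> regular_set B.
Proof.
apply: smallest_sub; last first.
  (* An open set is its own outer approximation, and an erosion is the closed inner one. *)
  move=> A /= oA e e0; have [r r0 Pr] := erosion_approx oA e0.
  exists [set x | ball x r `<=` A], A; split => //; first exact: closed_erosion.
  by move=> x /= xA; apply: xA; exact: ballxx.
split.
- by move=> e e0; exists set0, set0; split; rewrite ?setD0 ?measure0;
    [exact: closed0|exact: open0|by []..|rewrite lte_fin].
- move=> A rA e e0; have [F [U [cF oU FA AU PUF]]] := rA e e0.
  exists (~` U), (~` F); rewrite setTD; split; rewrite ?closedC ?openC//.
  + exact: subsetC.
  + exact: subsetC.
  + by rewrite setDE setCK setIC -setDE.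
- exact: regular_bigcup.
Qed.

Lemma borel_outer_regular (B : set T) (e : R) : borel_set B -> 0 < e ->
  exists U : set T, [/\ open U, B `<=` U & (P (U `\` B) < e%:E)%E].
Proof.
move=> bB e0; have [F [U [cF oU FB BU PUF]]] := borel_regular bB e0.
exists U; split => //; apply: le_lt_trans PUF; apply: le_measure; rewrite ?inE.
- by apply: measurableD; [exact: open_meas|exact: borel_set_measurable].
- by apply: measurableD; [exact: open_meas|exact: closed_measurable].
- exact: setDS.
Qed.

Lemma borel_setC (A : set T) : borel_set A -> borel_set (~` A).
Proof.
have [_ bC _] := @smallest_sigma_algebra T setT [set A : set T | open A].
by move=> bA; rewrite -setTD; exact: bC.
Qed.

Lemma borel_set_lim_sup (E : nat -> set T) :
  (forall i, borel_set (E i)) -> borel_set (lim_sup_set E).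
Proof.
(* In [B], the set [T] carries the Borel sigma-algebra, so closure properties of measurable sets
   become those of Borel sets. *)
move=> bE; pose B := g_sigma_algebraType [set A : set T | open A].
apply: (@bigcap_measurableType _ B) => n _.
by apply: (@bigcup_measurable _ B) => i _; exact: bE.
Qed.

(** * From local lower bounds to full measure *)

Lemma quasi_independent_lim_sup (f : R -> R) (E : nat -> set T) (A : set T) :
    (forall i, borel_set (E i)) -> measurable A -> 0 < f (fine (P A)) ->
    quasi_independent_in P f E A ->
  ((f (fine (P A)))%:E <= P (lim_sup_set E `&` A))%E.
Proof.
move=> bE mA fA [L [mL LE Loo QL]].
apply: le_trans (kochen_stone mL fA Loo QL) _; apply: le_measure; rewrite ?inE.
- by apply: bigcap_measurableType => n _; exact: bigcup_measurable.
- apply: measurableI => //.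
  by apply: borel_set_measurable; exact: borel_set_lim_sup.
- move=> x xL; split; last by have [n _ /LE[]] := xL 0%N I.
  by move=> n _; have [j nj /LE[]] := xL n I; exists j.
Qed.

Lemma full_measure_open_criterion (f : R -> R) (G : set T) :
    borel_set G -> (forall x, 0 < x -> 0 < f x) ->
    (forall x y, 0 < x -> x <= y -> f x <= f y) ->
    (forall A : set T, open A -> (0 < P A)%E ->
      ((f (fine (P A)))%:E <= P (G `&` A))%E) ->
  P G = 1%E.
Proof.
move=> bG f0 fi fG; apply: contrapT => PG1.
have mG := borel_set_measurable bG; have mGC := measurableC mG.
have GC0 : (0 < P (~` G))%E.
  rewrite lt0e measure_ge0 andbT; apply/eqP => GC0; apply: PG1.
  by rewrite -[G]setCK probability_setC// GC0 sube0.
have p0 : 0 < fine (P (~` G)).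
  by rewrite fine_gt0// GC0/= -ge0_fin_numE// fin_num_measure.
(* The tolerance is fixed before [U] is known; monotonicity of [f] later compares it with the value
   at the measure of [U]. *)
have [U [oU GU PU]] := borel_outer_regular (borel_setC bG) (f0 _ p0).
have mU := open_meas oU.
have PGU : (P (~` G) <= P U)%E by apply: le_measure; rewrite ?inE.
have := fG U oU (lt_le_trans GC0 PGU); apply/negP; rewrite -ltNge.
rewrite (_ : G `&` U = U `\` ~` G); last by rewrite setDE setCK setIC.
apply: lt_le_trans PU _; rewrite lee_fin fi// fine_le// fin_num_measure//.
Qed.

(** Removing a null open ball from [S] would leave a closed set of full measure missing [x], against
    minimality. *)
Lemma support_ball_gt0 (S : set T) (x : T) (r : R) :
  is_support P S -> S x -> 0 < r -> (0 < P (ball x r))%E.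
Proof.
move=> [cS PS minS] Sx r0; rewrite lt0e measure_ge0 andbT; apply/eqP => PB0.
have mB := ball_measurable x r.
have mS := closed_measurable cS.
have cSB : closed (S `\` ball x r).
  rewrite setDE; apply: closedI => //.
  by apply: open_closedC; exact: metric_ball_open.
suff : P (S `\` ball x r) = 1%E.
  by move=> /(minS _ cSB) /(_ x Sx)[_]; apply; exact: ballxx.
have PSB : P (S `&` ball x r) = 0%E.
  apply: (@subset_measure0 _ _ _ _ _ (ball x r)) => //.
  exact: measurableI.
have : P S = (P (S `\` ball x r) + P (S `&` ball x r))%E by exact: measureDI.
by rewrite PSB adde0 PS.
Qed.

(** A maximal disjoint family of balls is countable because each has positive measure. Every
    centre's ball meets a chosen one of the same radius, so the centre is within [2 * r] of the
    chosen centre. Empty sets pad the sequences at indices that name no ball. *)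
Lemma disjoint_ball_cover (A : set T) (r : R) : 0 < r ->
    (forall x, A x -> (0 < P (ball x r))%E) ->
  exists W V : nat -> set T, [/\ trivIset setT W, A `<=` \bigcup_n V n &
    forall n, (W n = set0 /\ V n = set0) \/
      (exists2 x, A x & W n = ball x r /\ V n = ball x (2 * r))].
Proof.
move=> r0 Apos.
have [D [DA tD maxD]] := ex_maximal_disjoint_subcollection (ball^~ r) A.
have cD : countable D.
  apply: (@countable_trivIset_measure_gt0 _ _ _ P _ _ (ball^~ r)) => // [x|x].
    exact: ball_measurable.
  by move=> /DA /Apos.
have [g ginj] := countable_injP _ cD.
(* The fibres of the injection [g] have at most one point, which turns the family over [D] into a
   sequence. *)
pose C n := [set x | D x /\ g x = n].
have C01 n : C n = set0 \/ exists2 x, A x & C n = [set x].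
  have [->|/set0P[x [Dx gx]]] := eqVneq (C n) set0; [by left|right].
  exists x; first exact: DA.
  apply/seteqP; split => [y [Dy gy]|y ->//]; apply: ginj; rewrite ?inE//.
  by rewrite gx gy.
exists (fun n => \bigcup_(x in C n) ball x r).
exists (fun n => \bigcup_(x in C n) ball x (2 * r)); split.
- move=> i j _ _ [z [[x [Dx gx] xz] [y [Dy gy] yz]]].
  by rewrite -gx -gy; congr g; apply: tD => //; exists z.
- move=> x Ax; suff [y Dy xy] : exists2 y, D y & ball y (2 * r) x.
    by exists (g y) => //; exists y.
  have [Dx|Dx] := pselect (D x).
    by exists x => //; apply: ballxx; rewrite mulr_gt0.
  have : ~ trivIset (D `|` [set x]) (ball^~ r).
    apply: maxD.
      rewrite properEneq; split; last by left.
      by apply/eqP => DE; apply: Dx; rewrite DE; right.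
    by move=> y [/DA|->].
  apply: contra_notP => nD; move=> i j.
  have meet y z : D y -> ball y r z -> ~ ball x r z.
    move=> Dy yz xz; apply: nD; exists y => //.
    by rewrite mulr_natl mulr2n; apply: ball_triangle yz _; exact: ball_sym.
  move=> [Di|->] [Dj|->] // [z [/= iz jz]]; first by apply: tD => //; exists z.
    by case: (meet _ _ Di iz).
  by case: (meet _ _ Dj jz).
- move=> n; have [->|[x Ax ->]] := C01 n; [left|right].
    by rewrite !bigcup_set0.
  by exists x => //; rewrite !bigcup_set1.
Qed.

Lemma full_measure_ball_criterion (S G : set T) (lambda c r2 : R) :
    is_support P S -> borel_set G -> 0 < c -> 0 <= lambda -> 0 < r2 ->
    (forall x r, S x -> 0 < r -> r < r2 ->
      (P (ball x (2 * r)) <= lambda%:E * P (ball x r))%E) ->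
    (forall x r, S x -> 0 < r -> r < r2 ->
      (c%:E * P (ball x r) <= P (G `&` ball x r))%E) ->
  P G = 1%E.
Proof.
move=> supS bG c0 l0 r20 dbl den; have [cS PS _] := supS.
have mS := closed_measurable cS.
have mG := borel_set_measurable bG; have mGC := measurableC mG.
pose N := S `\` G; have mN : measurable N by exact: measurableD.
have lc0 : 0 < lambda + c by rewrite ltr_wpDl.
(* As [S] has full measure, only the part of [S] outside [G] can matter. *)
suff PN0 : fine (P N) <= 0.
  apply/eqP; rewrite eq_le probability_le1//=.
  have -> : 1%E = P (S `&` G).
    rewrite -PS; have -> : P S = (P (S `\` G) + P (S `&` G))%E.
      exact: measureDI.
    rewrite -[X in (X + _)%E]fineK ?fin_num_measure//.
    have -> : fine (P (S `\` G)) = 0 by apply/eqP; rewrite eq_le PN0 fine_ge0.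
    by rewrite add0e.
  by apply: le_measure; rewrite ?inE//; exact: measurableI.
rewrite leNgt; apply/negP; set p := fine _ => p0.
(* This solves [delta + lambda / c * delta = p], the equality that closes the proof. *)
pose delta := c * p / (lambda + c).
have delta0 : 0 < delta by rewrite divr_gt0 ?mulr_gt0.
have [U [oU GU PU]] := borel_outer_regular (borel_setC bG) delta0.
have mU := open_meas oU.
have [r' r'0 PF] := erosion_approx oU delta0.
set F := [set x | _] in PF.
have mF : measurable F.
  by apply: closed_measurable => //; exact: closed_erosion.
(* The bound [r'] keeps balls centred in [F] inside [U]; halving [r2] gives the strict inequality
   that the hypotheses on balls require. *)
pose r := Num.min r' (r2 / 2).
have r0 : 0 < r by rewrite lt_min r'0 divr_gt0.
have rr2 : r < r2 by rewrite gt_min ltr_pdivrMr ?ltr_pMr ?ltr1n ?orbT.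
have [|W [V [tW NV WV]]] := @disjoint_ball_cover (N `&` F) r r0.
  by move=> x [[Sx _] _]; exact: support_ball_gt0 supS Sx r0.
have mW n : measurable (W n).
  by have [[-> _]|[x _ [-> _]]] := WV n => //; exact: ball_measurable.
have mV n : measurable (V n).
  by have [[_ ->]|[x _ [_ ->]]] := WV n => //; exact: ball_measurable.
have mNF : measurable (N `&` F) by exact: measurableI.
have PVW n : (P (V n) <= (lambda / c)%:E * P (G `&` W n))%E.
  have [[-> ->]|[x [[Sx _] _] [-> ->]]] := WV n.
    by rewrite setI0 measure0 mule0.
  apply: le_trans (dbl x r Sx r0 rr2) _.
  rewrite EFinM -muleA lee_wpmul2l ?lee_fin// muleC lee_pdivlMr//.
  by rewrite muleC; exact: den.
(* The doubled balls cover, while the original ones are disjoint and lie in [U], so their traces on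
   [G] have total measure at most that of the part of [U] in [G]. *)
have PNF : (P (N `&` F) <= (lambda / c)%:E * P (U `\` ~` G))%E.
  apply: (@le_trans _ _ (\sum_(n <oo) P (V n))%E).
    exact: measure_sigma_subadditive.
  apply: (@le_trans _ _ (\sum_(n <oo) ((lambda / c)%:E * P (G `&` W n)))%E).
    by apply: lee_nneseries.
  rewrite nneseriesZl//.
  rewrite lee_wpmul2l ?lee_fin ?divr_ge0 ?(ltW c0)//.
  have tGW : trivIset setT (fun n => G `&` W n) by exact: trivIset_setIl.
  have mGW n : measurable (G `&` W n) by exact: measurableI.
  have := @measure_bigcup _ _ _ P setT _ (fun n _ => mGW n) tGW.
  under eq_eseriesl do rewrite in_setT.
  move=> <-; apply: le_measure; rewrite ?inE.
  - exact: bigcupT_measurable.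
  - exact: measurableD.
  move=> x [n _ [Gx Wx]]; split; last by move=> nGx; exact: nGx Gx.
  have [[Wn _]|[y [_ Fy] [Wn _]]] := WV n; rewrite Wn// in Wx.
  by apply: Fy; apply: le_ball Wx; rewrite ge_min lexx.
(* The part of [N] outside [F] lies in [U] minus its erosion; strictness comes from there. *)
have : p < delta + lambda / c * delta.
  apply: (@lt_le_trans _ _ (delta + fine (P (N `&` F)))).
    have mNdF : measurable (N `\` F) by exact: measurableD.
    rewrite /p (fine_probabilityDI P mN mF) ltrD2r -lte_fin.
    rewrite fineK ?fin_num_measure//.
    apply: le_lt_trans PF; apply: le_measure; rewrite ?inE//.
      exact: measurableD.
    by move=> x [[_ Gx] Fx]; split => //; exact: GU.
  rewrite lerD2l -lee_fin fineK ?fin_num_measure//.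
  apply: le_trans PNF _; rewrite (EFinM (lambda / c)).
  rewrite lee_wpmul2l ?lee_fin ?divr_ge0 ?(ltW c0)//.
  exact: ltW.
suff -> : delta + lambda / c * delta = p by rewrite ltxx.
by rewrite /delta; field; rewrite !gt_eqF.
Qed.

End regularity.

Theorem mainTheorem3 (R : realType) (d : measure_display)
    (T : metricMeasurableType R d) (P : probability T R)
    (open_meas : forall A : set T, open A -> measurable A)
    (E : nat -> set T) (borelE : forall i, borel_set (E i)) :
  ((exists f : R -> R,
      [/\ forall x, 0 < x -> 0 < f x,
          forall x y, 0 < x -> x <= y -> f x <= f y,
          f x @[x --> 0^'+] --> (0 : R) &
          forall A : set T, open A -> (0 < P A)%E ->
            quasi_independent_in P f E A]) ->
    P (lim_sup_set E) = 1%E)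
  /\
  (forall (S : set T) (c r1 : R),
    is_support P S -> doubling P S ->
    0 < c -> c <= 1 -> 0 < r1 ->
    (forall (x : T) (r : R), S x -> 0 < r -> r < r1 ->
      quasi_independent_in P (fun y => c * y) E (ball x r)) ->
    P (lim_sup_set E) = 1%E).
Proof.
have bE := borel_set_lim_sup borelE.
have fineP_gt0 A : measurable A -> (0 < P A)%E -> 0 < fine (P A).
  by move=> mA PA; rewrite fine_gt0// PA/= -ge0_fin_numE// fin_num_measure.
split=> [[f [f_gt0 f_nd _ qi]]|].
  apply: (full_measure_open_criterion open_meas bE f_gt0 f_nd) => A oA PA.
  have mA := open_meas _ oA.
  by apply: quasi_independent_lim_sup (qi _ oA PA) => //; exact/f_gt0/fineP_gt0.
move=> S c r1 supS [lambda [r0 [l1 r0_gt0 dbl]]] c0 _ r10 qi.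
(* Below the minimum of the two radii, both doubling and the local lower bound hold. *)
apply: (@full_measure_ball_criterion _ _ _ P open_meas S _ lambda c
  (Num.min r0 r1)) => //.
- exact: le_trans l1.
- by rewrite lt_min r0_gt0.
- by move=> x r Sx r_gt0; rewrite lt_min => /andP[rr0 _]; exact: dbl.
- move=> x r Sx r_gt0; rewrite lt_min => /andP[_ rr1].
  have mB := ball_measurable open_meas x r.
  have := quasi_independent_lim_sup open_meas borelE mB _ (qi x r Sx r_gt0 rr1).
  rewrite EFinM fineK ?fin_num_measure//; apply; apply: mulr_gt0 => //.
  by apply: fineP_gt0 => //; exact: support_ball_gt0 supS Sx r_gt0.
Qed.
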